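(* Let $U\subseteq\mathbb{R}^3$ be open and let $f:U\to\mathbb{R}$ be a smooth function which admits a smooth conjugate function $g:U\to\mathbb{R}$. Then for every $\epsilon\in\mathbb{R}$ $$Z(f+\epsilon g)=(1+\epsilon^2)\bigl(Z(f)+\epsilon Z(g)\bigr).$$ Furthermore, $$Z(g)=\frac{d}{d\epsilon}Z(f+\epsilon g)\Big|_{\epsilon=0};$$ that is, $Z(g)=\mathcal{Z}_f(g)$, where $\mathcal{Z}_f$ is the linearisation of the operator $Z$ at $f$.
   Context: Two smooth real functions $f,g$ are conjugate if $\|\nabla f\|=\|\nabla g\|$ and $\langle\nabla f,\nabla g\rangle=0$ (Euclidean metric). Indices run over $1,2,3$ and refer to standard coordinates on $\mathbb{R}^3$; they are raised and lowered with the Euclidean metric and repeated indices are summed. For a smooth function $f$ with first and second partial derivatives $f_i$, $f_{ij}$, $$Z(f)=f^{ij}f_if_j+f^if_i\,f^j{}_j .$$ The linearisation of $Z$ at $f$ is $\mathcal{Z}_f(h)=\frac{d}{d\epsilon}Z(f+\epsilon h)\big|_{\epsilon=0}$. *)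

(* Defs.v *)
From HB Require Import structures.
From mathcomp Require Import all_boot all_order all_algebra.
From mathcomp Require Import all_classical all_reals all_analysis.

Set Implicit Arguments.
Unset Strict Implicit.
Unset Printing Implicit Defensive.

Import Order.TTheory GRing.Theory Num.Theory.
Import numFieldNormedType.Exports.

Local Open Scope classical_set_scope.
Local Open Scope ring_scope.

(* A function on an open set U of R^3 is encoded by a total function of which
   only the values on U matter: the partial derivatives at a point of the open
   set U depend only on the values near that point. *)

Definition partial (R : realType) (i : 'I_3) (f : 'rV[R]_3 -> R) :
    'rV[R]_3 -> R :=
  fun x => 'D_(delta_mx 0 i) f x.

Definition iter_partial (R : realType) (s : seq 'I_3) (f : 'rV[R]_3 -> R) :
    'rV[R]_3 -> R :=
  foldr (@partial R) f s.

(* C^oo on U: the iterated partial derivatives of all orders exist and are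
   continuous at each point of U.  'D_v is a total operator, hence the explicit
   existence clause. *)
Definition smooth_on (R : realType) (U : set 'rV[R]_3) (f : 'rV[R]_3 -> R) :
    Prop :=
  forall (s : seq 'I_3) (x : 'rV[R]_3), U x ->
    {for x, continuous (iter_partial s f)} /\
    forall i : 'I_3, derivable (iter_partial s f) x (delta_mx 0 i).

Definition grad (R : realType) (f : 'rV[R]_3 -> R) (x : 'rV[R]_3) : 'rV[R]_3 :=
  \row_(i < 3) partial i f x.

Definition edot (R : realType) (u v : 'rV[R]_3) : R :=
  \sum_(i < 3) u 0 i * v 0 i.

(* The library norm `|u| on 'rV[R]_3 is the maximum norm, not the Euclidean
   one. *)
Definition enorm (R : realType) (u : 'rV[R]_3) : R := Num.sqrt (edot u u).

Definition conjugate_on (R : realType) (U : set 'rV[R]_3)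
    (f g : 'rV[R]_3 -> R) : Prop :=
  forall x, U x ->
    enorm (grad f x) = enorm (grad g x) /\ edot (grad f x) (grad g x) = 0.

(* f^{ij} f_i f_j + f^i f_i f^j_j, where raising an index with the Euclidean
   metric in standard coordinates leaves the components unchanged, and
   f_{ij} is the j-th partial derivative of f_i. *)
Definition Zop (R : realType) (f : 'rV[R]_3 -> R) (x : 'rV[R]_3) : R :=
  (\sum_(i < 3) \sum_(j < 3)
     partial j (partial i f) x * partial i f x * partial j f x)
  + (\sum_(i < 3) partial i f x * partial i f x)
    * (\sum_(j < 3) partial j (partial j f) x).

Definition Zlin (R : realType) (f h : 'rV[R]_3 -> R) (x : 'rV[R]_3) : R :=
  derive1 (fun eps : R => Zop (fun y => f y + eps * h y) x) 0.

(* Main.v *)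
Require Import Defs.
From HB Require Import structures.
From mathcomp Require Import all_boot all_order all_algebra.
From mathcomp Require Import all_classical all_reals all_analysis.
From mathcomp Require Import ring.

Set Implicit Arguments.
Unset Strict Implicit.
Unset Printing Implicit Defensive.

Import Order.TTheory GRing.Theory Num.Theory.
Import numFieldNormedType.Exports.

Local Open Scope classical_set_scope.
Local Open Scope ring_scope.

(** Let h = f + eps g run through the pencil spanned by f and g.  The term
    f^{ij} f_i f_j of Z(f) is half the derivative of |grad f|^2 along grad f,
    so that
      Z(f) = 1/2 <grad |grad f|^2, grad f> + |grad f|^2 Laplacian(f)
    ([Zop_sqnorm_grad]).  In this form Z depends linearly on f once the function
    |grad f|^2 is kept apart.  Conjugacy gives |grad g|^2 = |grad f|^2 and
    |grad h|^2 = (1 + eps^2) |grad f|^2 on all of U ([sqnorm_grad_pencil]).  As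
    U is open these identities may be differentiated, so passing from f to h
    multiplies the quadratic part by 1 + eps^2 and replaces the linear part by
    its value at f plus eps times its value at g, which is the formula for Z(h)
    ([Zop_pencil]).  That formula is a polynomial in eps, and the coefficient
    of its linear term is Z(g). *)

Lemma edotC (R : realType) (u v : 'rV[R]_3) : edot u v = edot v u.
Proof. by apply: eq_bigr => i _; rewrite mulrC. Qed.

Lemma edotDr (R : realType) (u v w : 'rV[R]_3) (a : R) :
  edot u (v + a *: w) = edot u v + a * edot u w.
Proof.
rewrite /edot mulr_sumr -big_split; apply: eq_bigr => i _ /=.
by rewrite !mxE mulrDr mulrCA.
Qed.

Lemma edotZl (R : realType) (u v : 'rV[R]_3) (a : R) :
  edot (a *: u) v = a * edot u v.
Proof. by rewrite /edot mulr_sumr; apply: eq_bigr => i _; rewrite !mxE mulrA. Qed.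

Lemma edot_ge0 (R : realType) (u : 'rV[R]_3) : 0 <= edot u u.
Proof. by apply: sumr_ge0 => i _; rewrite -expr2 sqr_ge0. Qed.

Lemma enorm_eq_edot (R : realType) (u v : 'rV[R]_3) :
  enorm u = enorm v -> edot u u = edot v v.
Proof.
by move=> uv; rewrite -(sqr_sqrtr (edot_ge0 u)) -/(enorm u) uv sqr_sqrtr ?edot_ge0.
Qed.

(** Pythagoras: the cross term vanishes and both squares contribute the same
    squared norm. *)
Lemma edot_pencil (R : realType) (u v : 'rV[R]_3) (a : R) :
  edot v v = edot u u -> edot u v = 0 ->
  edot (u + a *: v) (u + a *: v) = (1 + a ^+ 2) * edot u u.
Proof.
move=> vv uv; rewrite edotDr 2!(edotC (u + a *: v)) !edotDr (edotC v u) vv uv.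
by ring.
Qed.

Definition sqnorm_grad (R : realType) (f : 'rV[R]_3 -> R) (x : 'rV[R]_3) : R :=
  edot (grad f x) (grad f x).

Definition laplacian (R : realType) (f : 'rV[R]_3 -> R) (x : 'rV[R]_3) : R :=
  \sum_(i < 3) partial i (partial i f) x.

Lemma eq_on_partial (R : realType) (U : set 'rV[R]_3) (f g : 'rV[R]_3 -> R)
    (i : 'I_3) (x : 'rV[R]_3) :
  open U -> U x -> (forall y, U y -> f y = g y) -> partial i f x = partial i g x.
Proof.
move=> oU Ux fg; apply: near_eq_derive; near=> y; apply: fg; near: y.
exact: open_nbhs_nbhs.
Unshelve. all: by end_near. Qed.

Lemma partial_pencil (R : realType) (f g : 'rV[R]_3 -> R) (a : R) (i : 'I_3)
    (x : 'rV[R]_3) :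
  derivable f x (delta_mx 0 i) -> derivable g x (delta_mx 0 i) ->
  partial i (fun y => f y + a * g y) x = partial i f x + a * partial i g x.
Proof.
move=> df dg; rewrite /partial.
have -> : (fun y => f y + a * g y) = f + (a \*: g) by [].
by rewrite (deriveD df (derivableZ (k := a) dg)) (deriveZ a dg).
Qed.

Lemma partial_scale (R : realType) (f : 'rV[R]_3 -> R) (a : R) (i : 'I_3)
    (x : 'rV[R]_3) :
  derivable f x (delta_mx 0 i) ->
  partial i (fun y => a * f y) x = a * partial i f x.
Proof. by move=> df; rewrite /partial -deriveMl. Qed.

Lemma sqnorm_gradE (R : realType) (f : 'rV[R]_3 -> R) :
  sqnorm_grad f = \sum_(i < 3) (partial i f * partial i f).
Proof.
apply/funext => y; rewrite /sqnorm_grad /edot fct_sumE.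
by apply: eq_bigr => i _; rewrite !mxE.
Qed.

Lemma derivable_sqnorm_grad (R : realType) (f : 'rV[R]_3 -> R)
    (x v : 'rV[R]_3) :
  (forall i, derivable (partial i f) x v) -> derivable (sqnorm_grad f) x v.
Proof.
move=> df; rewrite sqnorm_gradE; apply: derivable_sum => i.
exact: derivableM.
Qed.

Lemma partial_sqnorm_grad (R : realType) (f : 'rV[R]_3 -> R) (j : 'I_3)
    (x : 'rV[R]_3) :
  (forall i, derivable (partial i f) x (delta_mx 0 j)) ->
  partial j (sqnorm_grad f) x
  = 2 * \sum_(i < 3) partial j (partial i f) x * partial i f x.
Proof.
move=> df; rewrite sqnorm_gradE {1}/partial derive_sum; last first.
  by move=> i; exact: derivableM.
rewrite mulr_sumr; apply: eq_bigr => i _.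
by rewrite deriveM// -/(partial j (partial i f) x) /GRing.scale/=; ring.
Qed.

(** By the product rule, f^{ij} f_i is half the j-th partial derivative of
    |grad f|^2.  This form separates the quadratic dependence of Z on f, through
    the function |grad f|^2, from the linear one. *)
Lemma Zop_sqnorm_grad (R : realType) (f : 'rV[R]_3 -> R) (x : 'rV[R]_3) :
  (forall i j, derivable (partial i f) x (delta_mx 0 j)) ->
  Zop f x = 2^-1 * edot (grad (sqnorm_grad f) x) (grad f x)
            + sqnorm_grad f x * laplacian f x.
Proof.
move=> df; rewrite /Zop; congr (_ + _ * _); last first.
  by rewrite /sqnorm_grad /edot; apply: eq_bigr => i _; rewrite !mxE.
rewrite exchange_big mulr_sumr; apply: eq_bigr => j _ /=.
rewrite !mxE partial_sqnorm_grad// [RHS]mulrA (mulrA 2^-1).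
by rewrite mulVf ?pnatr_eq0// mul1r mulr_suml.
Qed.

Lemma smooth_on_derivable (R : realType) (U : set 'rV[R]_3)
    (f : 'rV[R]_3 -> R) (x : 'rV[R]_3) (i : 'I_3) :
  smooth_on U f -> U x -> derivable f x (delta_mx 0 i).
Proof. by move=> sf Ux; have [_] := sf [::] x Ux; exact. Qed.

Lemma smooth_on_derivable_partial (R : realType) (U : set 'rV[R]_3)
    (f : 'rV[R]_3 -> R) (x : 'rV[R]_3) (i j : 'I_3) :
  smooth_on U f -> U x -> derivable (partial i f) x (delta_mx 0 j).
Proof. by move=> sf Ux; have [_] := sf [:: i] x Ux; exact. Qed.

Lemma derivable_partial_pencil (R : realType) (U : set 'rV[R]_3)
    (f g : 'rV[R]_3 -> R) (a : R) (x : 'rV[R]_3) (i j : 'I_3) :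
  open U -> smooth_on U f -> smooth_on U g -> U x ->
  derivable (partial i (fun y => f y + a * g y)) x (delta_mx 0 j).
Proof.
move=> oU sf sg Ux.
apply: (@near_eq_derivable _ _ _ (partial i f + a \*: partial i g)).
  near=> y.
  have Uy : U y by near: y; exact: open_nbhs_nbhs.
  by rewrite partial_pencil//; exact: smooth_on_derivable Uy.
apply: derivableD; first exact: smooth_on_derivable_partial Ux.
by apply: derivableZ; exact: smooth_on_derivable_partial Ux.
Unshelve. all: by end_near. Qed.

Lemma grad_pencil (R : realType) (U : set 'rV[R]_3) (f g : 'rV[R]_3 -> R)
    (a : R) (x : 'rV[R]_3) :
  smooth_on U f -> smooth_on U g -> U x ->
  grad (fun y => f y + a * g y) x = grad f x + a *: grad g x.
Proof.
move=> sf sg Ux; apply/rowP => i; rewrite !mxE partial_pencil//.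
- exact: smooth_on_derivable Ux.
- exact: smooth_on_derivable Ux.
Qed.

Lemma laplacian_pencil (R : realType) (U : set 'rV[R]_3)
    (f g : 'rV[R]_3 -> R) (a : R) (x : 'rV[R]_3) :
  open U -> smooth_on U f -> smooth_on U g -> U x ->
  laplacian (fun y => f y + a * g y) x = laplacian f x + a * laplacian g x.
Proof.
move=> oU sf sg Ux; rewrite /laplacian mulr_sumr -big_split.
apply: eq_bigr => i _ /=; rewrite -partial_pencil.
- apply: eq_on_partial _ oU Ux _ => y Uy.
  by apply: partial_pencil; exact: smooth_on_derivable Uy.
- exact: smooth_on_derivable_partial Ux.
- exact: smooth_on_derivable_partial Ux.
Qed.

Lemma conjugate_on_sqnorm_grad (R : realType) (U : set 'rV[R]_3)
    (f g : 'rV[R]_3 -> R) (x : 'rV[R]_3) :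
  conjugate_on U f g -> U x -> sqnorm_grad g x = sqnorm_grad f x.
Proof. by move=> fg Ux; have [/enorm_eq_edot + _] := fg x Ux. Qed.

Lemma sqnorm_grad_pencil (R : realType) (U : set 'rV[R]_3)
    (f g : 'rV[R]_3 -> R) (a : R) (x : 'rV[R]_3) :
  smooth_on U f -> smooth_on U g -> conjugate_on U f g -> U x ->
  sqnorm_grad (fun y => f y + a * g y) x = (1 + a ^+ 2) * sqnorm_grad f x.
Proof.
move=> sf sg fg Ux; have [_ fg0] := fg x Ux.
rewrite /sqnorm_grad (grad_pencil _ sf sg Ux).
exact: edot_pencil (conjugate_on_sqnorm_grad fg Ux) fg0.
Qed.

Lemma Zop_pencil (R : realType) (U : set 'rV[R]_3) (f g : 'rV[R]_3 -> R)
    (a : R) (x : 'rV[R]_3) :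
  open U -> smooth_on U f -> smooth_on U g -> conjugate_on U f g -> U x ->
  Zop (fun y => f y + a * g y) x = (1 + a ^+ 2) * (Zop f x + a * Zop g x).
Proof.
move=> oU sf sg fg Ux; set h := fun y => f y + a * g y.
have ng y : U y -> sqnorm_grad g y = sqnorm_grad f y.
  exact: conjugate_on_sqnorm_grad.
have nh y : U y -> sqnorm_grad h y = (1 + a ^+ 2) * sqnorm_grad f y.
  exact: sqnorm_grad_pencil.
(* Both identities hold on the open set U, so they may be differentiated. *)
have dng : grad (sqnorm_grad g) x = grad (sqnorm_grad f) x.
  apply/rowP => j; rewrite [LHS]mxE [RHS]mxE.
  exact: eq_on_partial _ oU Ux ng.
have dnh : grad (sqnorm_grad h) x = (1 + a ^+ 2) *: grad (sqnorm_grad f) x.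
  apply/rowP => j; rewrite !mxE (eq_on_partial _ oU Ux nh).
  apply/partial_scale/derivable_sqnorm_grad => i.
  exact: smooth_on_derivable_partial Ux.
have Zf : Zop f x = 2^-1 * edot (grad (sqnorm_grad f) x) (grad f x)
    + sqnorm_grad f x * laplacian f x.
  by apply: Zop_sqnorm_grad => i j; exact: smooth_on_derivable_partial Ux.
have Zg : Zop g x = 2^-1 * edot (grad (sqnorm_grad f) x) (grad g x)
    + sqnorm_grad f x * laplacian g x.
  rewrite -dng -(ng x Ux); apply: Zop_sqnorm_grad => i j.
  exact: smooth_on_derivable_partial Ux.
have Zh : Zop h x = 2^-1 * edot (grad (sqnorm_grad h) x) (grad h x)
    + sqnorm_grad h x * laplacian h x.
  by apply: Zop_sqnorm_grad => i j; exact: derivable_partial_pencil Ux.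
rewrite Zf Zg Zh dnh (nh x Ux) (grad_pencil a sf sg Ux).
rewrite (laplacian_pencil a oU sf sg Ux) edotZl edotDr.
(* What remains is a polynomial identity in a and the following scalars. *)
generalize (edot (grad (sqnorm_grad f) x) (grad f x))
  (edot (grad (sqnorm_grad f) x) (grad g x)) (sqnorm_grad f x)
  (laplacian f x) (laplacian g x) => advf advg n lapf lapg.
by ring.
Qed.

Lemma is_derive_pencil0 (R : realType) (p q : R) :
  is_derive (0 : R) 1 (fun a : R => (1 + a ^+ 2) * (p + a * q)) q.
Proof.
have d1 : is_derive (0 : R) (1 : R) (cst 1 + id ^+ 2 : R -> R) 0.
  apply: (is_derive_eq (is_deriveD (is_derive_cst _ _ _)
    (is_deriveX 2 (is_derive_id _ _)))).
  by rewrite /= mulr0 scale0r addr0.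
have d2 : is_derive (0 : R) (1 : R) (cst p + q \*: id : R -> R) q.
  apply: (is_derive_eq (is_deriveD (is_derive_cst _ _ _)
    (is_deriveZ q (is_derive_id _ _)))).
  by rewrite add0r /GRing.scale /= mulr1.
have -> : (fun a : R => (1 + a ^+ 2) * (p + a * q))
    = (cst 1 + id ^+ 2) * (cst p + q \*: id).
  by apply/funext => a; rewrite !fctE /GRing.scale /= [a * q]mulrC.
apply: (is_derive_eq (is_deriveM d1 d2)).
by rewrite scaler0 addr0 !fctE expr0n addr0 scale1r.
Qed.

Theorem lemma14 (R : realType) (U : set 'rV[R]_3) (f g : 'rV[R]_3 -> R)
    (hU : open U) (hf : smooth_on U f) (hg : smooth_on U g)
    (hfg : conjugate_on U f g) :
  (forall (eps : R) (x : 'rV[R]_3), U x ->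
     Zop (fun y => f y + eps * g y) x
     = (1 + eps ^+ 2) * (Zop f x + eps * Zop g x))
  /\
  (forall x : 'rV[R]_3, U x ->
     derivable (fun eps : R => Zop (fun y => f y + eps * g y) x) 0 1 /\
     Zop g x = Zlin f g x).
Proof.
have Zpencil eps x := @Zop_pencil _ _ f g eps x hU hf hg hfg.
split=> // x Ux.
have [dZ Z'] : is_derive (0 : R) 1
    (fun eps : R => Zop (fun y => f y + eps * g y) x) (Zop g x).
  under eq_fun => eps do rewrite Zpencil//.
  exact: is_derive_pencil0.
by split; [exact: dZ | rewrite /Zlin derive1E Z'].
Qed.
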